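(* Let $M$ be a mean-field game (MFG) model on a finite undirected network $\Gamma$, let $W$ be the corresponding Wardrop model on the directed network $\bar\Gamma$, and let $\bar{\boldsymbol\jmath}^*$ be a Wardrop equilibrium of $W$. If all vertices are regular in the Wardrop model, then the MFG equations (1)–(6) hold for the currents, transition currents and value function recovered from $\bar{\boldsymbol\jmath}^*$.
   Context: **MFG model $M$.** $\Gamma=(E,V)$ is a finite undirected network; an edge $e_k$ with endpoints $v_r,v_i$ is written $e_k=(v_r,v_i)$. Some vertices are entrance vertices and some others (disjoint from these) are exit vertices; all of them have incidence $1$. A current $\iota>0$ is prescribed at each entrance vertex; the exit cost is zero at each exit vertex. Each edge $e_k=(v_r,v_i)$ is identified with $[0,1]$ ($v_r$ with $0$, $v_i$ with $1$) and carries a Hamiltonian $H_k(x,p,m)$, smooth and convex in $p$, with Lagrangian $L_k(x,v,m)=\sup_p\{-pv-H_k(x,p,m)\}$. For $j\in\mathbb R$, $m^k(x,j)$ denotes the density determined by the edge MFG system $H_k(x,u_x,m)=0$, $-mD_pH_k(x,u_x,m)=j$. The travel costs are $c_k^i(j)=\min\int_0^T L_k(x,\dot x,m^k(x,j))\,dt$ over all $T$ and Lipschitz trajectories with $x(0)=0$, $x(T)=1$ (moving from $v_r$ to $v_i$), and $c_k^r(j)$, the same with $x(0)=1$, $x(T)=0$ (moving from $v_i$ to $v_r$). Moving from $e_k$ to $e_l$ through a common vertex $v_i$ costs a constant (switching cost) $\psi_{kl}^i$, with $\psi^i_{kl}\le\psi^i_{kp}+\psi^i_{pl}$ at vertices with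 more than two incident edges. (If auxiliary edges have been attached to the network to obtain entrance and exit vertices of incidence $1$ and zero exit cost, then: on an auxiliary entrance edge the travel cost into the network is $0$ and in the opposite direction $+\infty$; on an auxiliary exit edge the travel cost towards the exit is the original exit cost and in the opposite direction $+\infty$; switching from an entrance edge to an original edge costs $0$ and the reverse $+\infty$; switching from an original edge to an exit edge costs $0$ and the reverse $+\infty$.) Unknowns of $M$: for each edge $e_k=(v_r,v_i)$, currents $j_k^i,j_k^r\ge0$ (towards $v_i$, respectively $v_r$), with $j_k=j_k^i-j_k^r$; transition currents $j_{kl}^i\ge 0$ from $e_k$ to $e_l$ ($k\ne l$) through a common vertex $v_i$; and the values $u_k^i$ of the value function for each pair (edge $e_k$, endpoint $v_i$ of $e_k$). The MFG equations are: (1) $j_k^ij_k^r=0$ and $j_{kl}^ij_{lk}^i=0$; (2) $u_k^i\le u_l^i+\psi_{kl}^i$ and $j_{kl}^i\,(u_k^i-u_l^i-\psi_{kl}^i)=0$ for all $i,k,l$; (3) on each edge $e_k=(v_r,v_i)$: $u_k^r\le c_k^i(j_k)+u_k^i$, $u_k^i\le c_k^r(j_k)+u_k^r$, $j_k^i(u_k^r-u_k^i-c_k^i(j_k))=0$, $j_k^r(u_k^i-u_k^r-c_k^r(j_k))=0$; (4) for every edge $e_k=(v_r,v_i)$ and endpoint $v_i$ that is neither an entrance nor an exit, with $\mathcal E$ the set of edges other than $e_k$ incident at $v_i$: $\sum_{e_l\in\mathcal E}j_{kl}^i=j_k^i$ and $\sum_{e_l\in\mathcal E}j_{lk}^i=j_k^r$;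 (5) if $e_k=(v_r,v_i)$ with $v_r$ an entrance vertex with entry current $\iota$: $j_k^i=\iota$, $j_k^r=0$; (6) if $e_l=(v_i,v_s)$ with $v_s$ an exit vertex: $j_l^i=0$, and $u_l^s\le0$ with equality if $j_l^s>0$. **Corresponding Wardrop model $W$.** The vertices of the directed network $\bar\Gamma$ are the pairs $(e_k,v_i)$ with $v_i$ an endpoint of $e_k$. For each edge $e_k=(v_r,v_i)$ there are directed edges $\bar e_k^i$ from $(e_k,v_r)$ to $(e_k,v_i)$ and $\bar e_k^r$ from $(e_k,v_i)$ to $(e_k,v_r)$; for distinct edges $e_k,e_l$ with a common vertex $v_i$ there is a transition edge $\bar e_{kl}^i$ from $(e_k,v_i)$ to $(e_l,v_i)$. The directed edges pointing into an entrance vertex or out of an exit vertex are deleted. The currents $j_k^i$, $j_{kl}^i$ correspond to the currents on $\bar e_k^i$, $\bar e_{kl}^i$. The cost on $\bar e_k^i$ is $c_k^i(j_k^i-j_k^r)$, on $\bar e_k^r$ it is $c_k^r(j_k^r-j_k^i)$, and on $\bar e_{kl}^i$ it is $\psi_{kl}^i$; $\bar{\boldsymbol c}(\bar{\boldsymbol\jmath})$ is the vector of these costs. $\mathcal A$ is the set of $\bar{\boldsymbol\jmath}\ge0$ satisfying Kirchhoff's law: at every non-exit vertex of $\bar\Gamma$, (sum of outgoing currents) $-$ (sum of incoming currents) equals the prescribed entry current at entrance vertices and $0$ at the others. A Wardrop equilibrium is $\bar{\boldsymbol\jmath}^*\in\mathcal A$ with $\langle\bar{\boldsymbol c}(\bar{\boldsymbol\jmath}^*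 ),\bar{\boldsymbol\jmath}^*-\bar{\boldsymbol\jmath}\rangle\le0$ for all $\bar{\boldsymbol\jmath}\in\mathcal A$. **Quantities recovered from $\bar{\boldsymbol\jmath}^*$.** A vertex of $\bar\Gamma$ is regular if it belongs to an edge on which $\bar{\boldsymbol\jmath}^*$ is positive. The current $j_k$ in an edge $e_k=(v_r,v_i)$ is the difference $j_k^i-j_k^r$ of the equilibrium currents on the two directed edges associated with $e_k$; the transition currents are the equilibrium currents on the transition edges. The value function $\tilde u_k^i$ at a regular vertex $(e_k,v_i)$ is the sum of the costs, evaluated at $\bar{\boldsymbol\jmath}^*$, of the edges of a positively directed walk (a walk through regular vertices connected by edges with positive current) from that vertex to an exit vertex.
   Formalization: Switching costs are further assumed to allow no free detours: ψ_kl+ψ_lk>0, and ψ_kl<ψ_kp+ψ_pl for distinct k,p,l whenever the right side is finite; otherwise current added to a free cycle or detour keeps a Wardrop equilibrium but violates (1) or (4). *)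

(* Defs.v *)
From HB Require Import structures.
From mathcomp Require Import all_boot all_order all_algebra.
From mathcomp Require Import all_classical all_reals all_analysis.
Import Order.TTheory GRing.Theory Num.Theory.
Import numFieldNormedType.Exports.

Set Implicit Arguments.
Unset Strict Implicit.
Unset Printing Implicit Defensive.

Local Open Scope ring_scope.

(* Iterated directional derivatives; all partial derivatives are among them. *)
Definition iter_derive (R : realType) (V : normedModType R)
    (f : V -> R) (vs : seq V) : V -> R :=
  foldr (fun v g => 'D_v g) f vs.

(* C^oo on an open neighbourhood of [D]; for a set with boundary, such as
   [0, 1] x R x [0, +oo[, this is smoothness up to the boundary. *)
Definition smooth_on (R : realType) (V : normedModType R)
    (D : set V) (f : V -> R) : Prop :=
  exists U : set V, [/\ open U, (D `<=` U)%classic &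
    forall (vs : seq V) (z : V), U z ->
      {for z, continuous (iter_derive f vs)} /\
      forall v, derivable (iter_derive f vs) z v].

Section SingleEdge.
Local Open Scope classical_set_scope.
Variable R : realType.
Implicit Types (H : R -> R -> R -> R) (x p v m : R).

Definition lagrangian H x v m : \bar R :=
  ereal_sup (range (fun p : R => (- (p * v) - H x p m)%:E)).

(* [(u, m)] is a classical solution of the edge system with current [j]. The
   function [derive1 (H x ^~ (m x))] is p |-> D_p H (x, p, m x). *)
Definition edge_mfg_system H (j : R) (u m : R -> R) : Prop :=
  [/\ forall x, 0 <= x <= 1 -> derivable u x 1,
      {within `[0, 1], continuous (derive1 u)},
      {within `[0, 1], continuous m},
      forall x, 0 <= x <= 1 -> H x (derive1 u x) (m x) = 0 &
      forall x, 0 <= x <= 1 -> - m x * derive1 (H x ^~ (m x)) (derive1 u x) = j].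

(* Lipschitz trajectories in the edge, from [a] to [b] in time [T]. *)
Definition trajectory (a b T : R) (y : R -> R) : Prop :=
  [/\ 0 < T, [lipschitz y t | t in `[0, T]],
      forall t : R, 0 <= t <= T -> 0 <= y t <= 1,
      y 0 = a & y T = b].

(* A Lipschitz [y] is differentiable almost everywhere on [0, T], so the values
   of [derive1 y] elsewhere are irrelevant. *)
Definition action H (m : R -> R) (T : R) (y : R -> R) : \bar R :=
  (\int[lebesgue_measure]_(t in `[0%R, T])
     lagrangian H (y t) (derive1 y t) (m (y t)))%E.

Definition actions H (m : R -> R) (a b : R) : set \bar R :=
  [set c | exists T y, trajectory a b T y /\ c = action H m T y].

End SingleEdge.

(* A pair (e_k, endpoint of e_k), i.e. a vertex of the directed network, is
   encoded as [(k, b)]: in the identification of e_k with [0, 1], [(k, false)]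
   is the endpoint at 0 and [(k, true)] the endpoint at 1. *)
Definition half_edge (E : finType) : Type := (E * bool)%type.
HB.instance Definition _ (E : finType) := Finite.on (half_edge E).

Definition opp_half (E : finType) (h : half_edge E) : half_edge E :=
  (h.1, ~~ h.2).

(* Potential directed edges of the Wardrop network: [Travel h] goes from
   [opp_half h] to [h], and [Transition h h'] from [h] to [h']. *)
Definition darc (E : finType) : Type :=
  (half_edge E + half_edge E * half_edge E)%type.
HB.instance Definition _ (E : finType) := Finite.on (darc E).

Definition Travel (E : finType) (h : half_edge E) : darc E := inl h.
Definition Transition (E : finType) (h h' : half_edge E) : darc E :=
  inr (h, h').

Definition source (E : finType) (a : darc E) : half_edge E :=
  match a with inl h => opp_half h | inr (h, _) => h end.
Definition target (E : finType) (a : darc E) : half_edge E :=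
  match a with inl h => h | inr (_, h') => h' end.

Record network (R : realType) (V E : finType) := Network {
  vert : half_edge E -> V;
  vert_neq : forall k, vert (k, false) != vert (k, true);
  entrance : {set V};
  exit : {set V};
  entrance_exit_disj : [disjoint entrance & exit];
  boundary_incidence : forall v, v \in entrance :|: exit ->
    #|[set h : half_edge E | vert h == v]| = 1%N;
  entry_current : V -> R;
  entry_current_gt0 : forall v, v \in entrance -> 0 < entry_current v }.

Inductive edge_kind := Original | AuxEntrance | AuxExit.

Record mfg_data (R : realType) (V E : finType) := MfgData {
  net :> network R V E;
  kind : E -> edge_kind;
  hamiltonian : E -> R -> R -> R -> R;
  (* the admissible densities: [0, +oo[, or ]0, +oo[ when the Hamiltonian is
     singular at m = 0 *)
  density_range : E -> set R;
  (* [density k j x] is m^k(x, j) *)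
  density : E -> R -> R -> R;
  exit_cost : E -> R;
  (* [switching (k, b) (l, c)] is psi_kl^i, for the common vertex
     v_i = [vert (k, b)] = [vert (l, c)] *)
  switching : half_edge E -> half_edge E -> \bar R }.

Section Model.
Variables (R : realType) (V E : finType) (M : mfg_data R V E).
Implicit Types (h : half_edge E) (k : E).

Definition switchable h h' : bool := (h.1 != h'.1) && (vert M h == vert M h').

(* The travel cost on the edge [h.1] towards its endpoint [h]. The argument [j]
   is the current in the edge counted positively from 0 to 1, whichever the
   direction of travel: it enters only through the density m^k(., j). *)
Definition travel_cost h (j : R) : \bar R :=
  match kind M h.1 with
  | Original => ereal_inf
      (actions (hamiltonian M h.1) (density M h.1 j) ((~~ h.2)%:R) (h.2%:R))
  | AuxEntrance => if vert M h \in entrance M then +oo%E else 0%E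
  | AuxExit => if vert M h \in exit M then (exit_cost M h.1)%:E else +oo%E
  end.

Record mfg_model : Prop := MfgModel {
  density_rangeP : forall k (m : R),
    (0 < m -> density_range M k m) /\ (density_range M k m -> 0 <= m);
  hamiltonian_smooth : forall k, kind M k = Original ->
    smooth_on
      [set z : R * R * R | 0 <= z.1.1 <= 1 /\ density_range M k z.2]%classic
      (fun z : R * R * R => hamiltonian M k z.1.1 z.1.2 z.2);
  hamiltonian_convex : forall k, kind M k = Original ->
    forall x m : R, 0 <= x <= 1 -> density_range M k m ->
    convex_function [set: R^o]%classic (hamiltonian M k x ^~ m);
  density_system : forall k, kind M k = Original -> forall j : R,
    (forall x : R, 0 <= x <= 1 -> density_range M k (density M k j x)) /\
    exists u, edge_mfg_system (hamiltonian M k) j u (density M k j);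
  (* the infimum defining the travel cost is a minimum *)
  travel_cost_min : forall h, kind M h.1 = Original -> forall j : R,
    actions (hamiltonian M h.1) (density M h.1 j) ((~~ h.2)%:R) (h.2%:R)
      (travel_cost h j);
  aux_entranceP : forall k, kind M k = AuxEntrance ->
    exists b, vert M (k, b) \in entrance M /\
              vert M (k, ~~ b) \notin entrance M :|: exit M;
  aux_exitP : forall k, kind M k = AuxExit ->
    exists b, vert M (k, b) \in exit M /\
              vert M (k, ~~ b) \notin entrance M :|: exit M;
  (* the switching costs between two auxiliary edges are only required not to
     be -oo *)
  switchingP : forall h h', switchable h h' ->
    match kind M h.1, kind M h'.1 return Prop with
    | Original, Original => switching M h h' \is a fin_num
    | AuxEntrance, Original | Original, AuxExit => switching M h h' = 0%E
    | Original, AuxEntrance | AuxExit, Original => switching M h h' = +oo%E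
    | _, _ => switching M h h' != -oo%E
    end;
  switching_triangle : forall h h' h'',
    switchable h h' -> switchable h' h'' -> switchable h h'' ->
    (switching M h h'' <= switching M h h' + switching M h' h'')%E }.

(* No detour through a third edge at a vertex is free: the triangle inequality
   is strict, including in the degenerate case of a detour from an edge to
   itself. It is vacuous for detours of infinite cost. Free detours could be
   added to an equilibrium at will, and break [mfg_one_way_transition] and the
   balance equations below. *)
Definition strict_switching : Prop :=
  (forall h h', switchable h h' ->
     (0 < switching M h h' + switching M h' h)%E) /\
  (forall h h' h'', switchable h h' -> switchable h' h'' -> switchable h h'' ->
     (switching M h h' + switching M h' h'' < +oo)%E ->
     (switching M h h'' < switching M h h' + switching M h' h'')%E).

(* [jc (k, b)] is the current in e_k towards the endpoint [(k, b)], [jt h h'] is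
   the transition current, and [u h] is the value at the pair [h]. *)
Record mfg_equations (jc : half_edge E -> R)
    (jt : half_edge E -> half_edge E -> R) (u : half_edge E -> R) : Prop :=
  MfgEquations {
  mfg_current_ge0 : forall h, 0 <= jc h;
  mfg_transition_ge0 : forall h h', switchable h h' -> 0 <= jt h h';
  mfg_one_way : forall h, jc h * jc (opp_half h) = 0;
  mfg_one_way_transition : forall h h', switchable h h' -> jt h h' * jt h' h = 0;
  mfg_switching_le : forall h h', switchable h h' ->
    ((u h)%:E <= (u h')%:E + switching M h h')%E;
  mfg_switching_eq : forall h h', switchable h h' ->
    ((jt h h')%:E * ((u h)%:E - (u h')%:E - switching M h h') = 0)%E;
  (* with [h = (k, b)], the current j_k is [jc (k, true) - jc (k, false)] *)
  mfg_travel_le : forall h,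
    ((u (opp_half h))%:E <=
       travel_cost h (jc (h.1, true) - jc (h.1, false)) + (u h)%:E)%E;
  mfg_travel_eq : forall h,
    ((jc h)%:E * ((u (opp_half h))%:E - (u h)%:E -
       travel_cost h (jc (h.1, true) - jc (h.1, false))) = 0)%E;
  mfg_balance_out : forall h, vert M h \notin entrance M :|: exit M ->
    \sum_(h' | switchable h h') jt h h' = jc h;
  mfg_balance_in : forall h, vert M h \notin entrance M :|: exit M ->
    \sum_(h' | switchable h h') jt h' h = jc (opp_half h);
  mfg_entrance : forall h, vert M h \in entrance M ->
    jc (opp_half h) = entry_current M (vert M h) /\ jc h = 0;
  mfg_exit_current : forall h, vert M h \in exit M -> jc (opp_half h) = 0;
  mfg_exit_value : forall h, vert M h \in exit M ->
    u h <= 0 /\ (0 < jc h -> u h = 0) }.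

(* the directed edges that remain after the deletion at entrances and exits *)
Definition is_arc (a : darc E) : bool :=
  [&& match a with inl _ => true | inr (h, h') => switchable h h' end,
      vert M (target a) \notin entrance M & vert M (source a) \notin exit M].

Implicit Types j : darc E -> R.

(* [signed h z] counts from 0 to 1 a current [z] counted towards [h]. *)
Definition signed h (z : R) : R := if h.2 then z else - z.

(* The cost of [Travel h] is the travel cost at the net current in the edge,
   which is [j (Travel h) - j (Travel (opp_half h))] when counted towards [h]. *)
Definition wardrop_cost j (a : darc E) : \bar R :=
  match a with
  | inl h => travel_cost h
               (signed h (j (Travel h) - j (Travel (opp_half h))))
  | inr (h, h') => switching M h h'
  end.

Definition entry h : R :=
  if vert M h \in entrance M then entry_current M (vert M h) else 0.

(* the set A of admissible currents; vectors of currents are extended by 0 to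
   the potential directed edges that are not in the network *)
Definition admissible j : Prop :=
  [/\ forall a, is_arc a -> 0 <= j a,
      forall a, ~~ is_arc a -> j a = 0 &
      forall h, vert M h \notin exit M ->
        \sum_(a | is_arc a && (source a == h)) j a
        - \sum_(a | is_arc a && (target a == h)) j a = entry h].

(* In the product of extended reals, 0 * +oo = 0. *)
Definition wardrop_equilibrium js : Prop :=
  admissible js /\
  forall j, admissible j ->
    (\sum_(a | is_arc a) wardrop_cost js a * (js a - j a)%:E <= 0)%E.

Definition regular j h : Prop :=
  exists a, [/\ is_arc a, 0 < j a & source a = h \/ target a = h].

(* positively directed walks from [h] to [h'], as sequences of directed edges *)
Fixpoint positive_walk j h (s : seq (darc E)) h' : Prop :=
  match s with
  | [::] => h = h'
  | a :: s' => [/\ is_arc a, 0 < j a, source a = h &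
                   positive_walk j (target a) s' h']
  end.

Definition wardrop_value j (u : half_edge E -> R) : Prop :=
  forall h, regular j h -> exists s h',
    [/\ positive_walk j h s h', vert M h' \in exit M &
        (u h)%:E = (\sum_(a <- s) wardrop_cost j a)%E].

Definition edge_current j h : R := j (Travel h).
Definition transition_current j h h' : R := j (Transition h h').

End Model.

(* Main.v *)
(** A small amount of current can be rerouted from a walk carrying positive
current to any other walk with the same origin that ends at the same vertex or
also leads to an exit. Equilibrium therefore forces the first walk to be at most
as costly as the second. Taking the walks that define the values, this gives
[u (source a) <= cost a + u (target a)] on every directed edge, with equality
where the current is positive. It also excludes positive cycles of positive
cost, hence two opposite positive currents, and positive detours, hence the
balance equations.

That a round trip in an edge has positive cost is where the edge system enters.
Since [H (x, u', m) = 0], the Lagrangian dominates [- u' v], so the way out costs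
at least [u 0 - u 1] and the way back at least [u 1 - u 0]. If [H (x, ., m x)]
takes a negative value at some [x], the momentum can be changed near [x] so as to
gain in the sum of the two bounds; otherwise [u'] minimizes [H], and a constant
change of the momentum on the way out gains to first order and loses only to
second order. Integrating these bounds along Lipschitz trajectories requires the
fundamental theorem of calculus for Lipschitz functions, obtained here from the
Radon-Nikodym and Lebesgue differentiation theorems. *)
Require Import Defs.
From HB Require Import structures.
From mathcomp Require Import all_boot all_order all_algebra.
From mathcomp Require Import all_classical all_reals all_analysis.
From mathcomp Require Import measurable_realfun ring lra.
Import Order.TTheory GRing.Theory Num.Theory.
Import numFieldNormedType.Exports.

Set Implicit Arguments.
Unset Strict Implicit.
Unset Printing Implicit Defensive.

Local Open Scope classical_set_scope.
Local Open Scope ring_scope.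

(** * Lipschitz functions and the fundamental theorem of calculus *)

Lemma lebesgue_stieltjes_measure_itv_oc (R : realType) (F : cumulative R R)
    (a b : R) : a <= b ->
  lebesgue_stieltjes_measure F `]a, b] = (F b - F a)%:E.
Proof.
move=> ab; rewrite /lebesgue_stieltjes_measure /measure_extension/=.
rewrite measurable_mu_extE/= ?wlength_itv_bnd//; exact: is_ocitv.
Qed.

(* [F] and [x - F x] define measures whose sum is the Lebesgue measure, so the
   first is absolutely continuous. *)
Lemma lipschitz_nondecreasing_density (R : realType) (F : R -> R) (a b : R) :
  nondecreasing F -> nondecreasing (fun x => x - F x) ->
  exists f : R -> R,
    [/\ forall x, 0 <= f x, lebesgue_measure.-integrable setT (EFin \o f) &
     forall x, a <= x <= b ->
      (F x - F a)%:E = (\int[lebesgue_measure]_(t in `]a, x]) (f t)%:E)%E].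
Proof.
move=> ndF ndG.
have Flip x y : x <= y -> 0 <= F y - F x <= y - x.
  by move=> xy; have := ndF _ _ xy; have := ndG _ _ xy; lra.
have cF : continuous F.
  move=> x; apply/cvgrPdist_le => e e0; near=> y.
  have : `|x - y| <= e by near: y; exact: cvgr_dist_le.
  rewrite !ler_norml.
  have [xy|yx] := leP x y; first by have := Flip _ _ xy; lra.
  by have := Flip _ _ (ltW yx); lra.
have cG : continuous (fun x => x - F x).
  by move=> x; apply: cvgB; [exact: cvg_id|exact: cF].
pose F' : cumulative R R := HB.pack F
  (isCumulative.Build R _ R F ndF (right_continuousW cF)).
pose G' : cumulative R R := HB.pack (fun x => x - F x)
  (isCumulative.Build R _ R (fun x => x - F x) ndG (right_continuousW cG)).
pose muF : {measure set (measurableTypeR R) -> \bar R} := lebesgue_stieltjes_measure F'.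
pose muG : {measure set (measurableTypeR R) -> \bar R} := lebesgue_stieltjes_measure G'.
have muFE (c d : R) : c <= d -> muF `]c, d]%classic = (F d - F c)%:E.
  exact: (@lebesgue_stieltjes_measure_itv_oc _ F').
have muGE (c d : R) : c <= d -> muG `]c, d]%classic = ((d - F d) - (c - F c))%:E.
  exact: (@lebesgue_stieltjes_measure_itv_oc _ G').
have FG A : measurable A -> lebesgue_measure A = (muF A + muG A)%E.
  move=> mA; rewrite -(measure_addE muF muG).
  apply: (lebesgue_measure_unique (mu := measure_add muF muG)) => //.
  move=> _ [[c d] _ <-]; rewrite [RHS](measure_addE muF muG).
  have [cd|dc] := leP c d; last first.
    by rewrite set_itv_ge ?measure0 ?adde0// bnd_simp -leNgt ltW.
  rewrite [LHS](@lebesgue_stieltjes_measure_itv_oc _ idfun c d cd) muFE// muGE//.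
  by rewrite -EFinD; congr EFin => /=; lra.
have mab : measurable (`]a, b]%classic : set (measurableTypeR R)) by [].
have muFab : (muF `]a, b]%classic < +oo)%E.
  have [ab|ba] := leP a b; first by rewrite muFE// ltry.
  by rewrite set_itv_ge ?measure0// bnd_simp -leNgt ltW.
(* [muF] may have infinite total mass, while the Radon-Nikodym theorem is applied to a finite
   measure; hence the restriction to []a, b]]. *)
pose nu : {finite_measure set (measurableTypeR R) -> \bar R} := mfrestr mab muFab.
have nuE A : nu A = muF (A `&` `]a, b]%classic) by [].
have numu : nu `<< lebesgue_measure.
  apply/null_content_dominatesP => A mA A0; apply/eqP.
  have FA : lebesgue_measure A = 0%E := A0.
  rewrite nuE eq_le measure_ge0 andbT -FA FG//.
  apply: (@le_trans _ _ (muF A)); last by rewrite leeDl.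
  by apply: le_measure; rewrite ?inE//; exact: measurableI.
have [f [f0 ffin fint fE]] :=
  radon_nikodym_sigma_finite (mu := @lebesgue_measure R) (nu := nu) numu.
exists (fine \o f); have feq : EFin \o (fine \o f) = f.
  by apply/funext => x /=; rewrite fineK.
split.
- by move=> x; exact: fine_ge0.
- by rewrite feq.
- move=> x /andP[ax xb].
  transitivity (\int[lebesgue_measure]_(t in `]a, x]) f t)%E; last first.
    by apply: eq_integral => t _ /=; rewrite fineK.
  rewrite -fE// nuE setIidl; last exact: subset_itvl.
  by rewrite muFE.
Unshelve. all: by end_near. Qed.
(** The retraction of the line onto [[a, b]]: composing with it extends a function from the segment
    to the line and keeps continuity or a Lipschitz bound. *)
Definition clamp (R : realDomainType) (a b x : R) : R :=
  Num.max a (Num.min b x).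

Lemma clamp_itv (R : realDomainType) (a b x : R) :
  a <= b -> a <= clamp a b x <= b.
Proof. by move=> ab; rewrite /clamp le_max lexx/= ge_max ab/= ge_min lexx. Qed.

Lemma clamp_id (R : realDomainType) (a b x : R) :
  a <= x <= b -> clamp a b x = x.
Proof. by move=> /andP[ax xb]; rewrite /clamp (min_idPr xb) (max_idPr ax). Qed.

Lemma clamp_le (R : realDomainType) (a b x y : R) :
  a <= b -> x <= y -> 0 <= clamp a b y - clamp a b x <= y - x.
Proof.
move=> ab xy; rewrite /clamp /Num.max /Num.min.
by do ! case: ifPn; rewrite -?leNgt; lra.
Qed.

(** After extension by [clamp], both [k x + f] and [k x - f] are nondecreasing. Dividing the first
    by [2 k] gives an [F] with integrable density [h], so that [2 k h - k] is a density for [f], and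
    its derivative almost everywhere by Lebesgue differentiation. *)
Lemma lipschitz_FTC (R : realType) (f : R -> R) (k a b : R) :
  a < b -> 0 < k ->
  (forall s t, a <= s <= b -> a <= t <= b -> `|f s - f t| <= k * `|s - t|) ->
  exists g : R -> R,
    [/\ lebesgue_measure.-integrable `[a, b] (EFin \o g),
        (\int[lebesgue_measure]_(t in `[a, b]) (g t)%:E = (f b - f a)%:E)%E &
        {ae lebesgue_measure, forall t, a < t < b -> is_derive t (1 : R) f (g t)}].
Proof.
move=> ab k0 flip.
pose cl := clamp a b.
have clab x : a <= cl x <= b by exact/clamp_itv/ltW.
have clid x : a <= x <= b -> cl x = x by exact: clamp_id.
have clle x y : x <= y -> 0 <= cl y - cl x <= y - x by exact/clamp_le/ltW.
have fcl x y : x <= y -> `|f (cl y) - f (cl x)| <= k * (y - x).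
  move=> xy; have /andP[h1 h2] := clle _ _ xy.
  apply: le_trans (flip _ _ (clab _) (clab _)) _.
  by rewrite ler_pM2l// ger0_norm.
pose F x := (f (cl x) + k * x) / (2 * k).
have k20 : 0 < 2 * k by lra.
have ndF : nondecreasing F.
  move=> x y xy; rewrite /F ler_pM2r ?invr_gt0//.
  by have := fcl _ _ xy; rewrite ler_norml; nra.
have ndG : nondecreasing (fun x => x - F x).
  move=> x y xy; rewrite -(ler_pM2r k20) !mulrBl /F !divfK ?gt_eqF//.
  by have := fcl _ _ xy; rewrite ler_norml; nra.
have [h [h0 hint hE]] := lipschitz_nondecreasing_density a b ndF ndG.
have hintS (A : set R) : measurable A ->
    lebesgue_measure.-integrable A (EFin \o h).
  by move=> mA; apply: integrableS hint.
pose I x := (\int[lebesgue_measure]_(t in `]a, x]) h t)%R.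
have IE x : a <= x <= b -> I x = F x - F a.
  by move=> axb; rewrite /I /Rintegral -hE.
have fE x : a <= x <= b -> f x = 2 * k * I x - k * (x - a) + f a.
  move=> axb; rewrite IE// /F !clid//; last by rewrite lexx ltW.
  by field; rewrite gt_eqF.
have kint : lebesgue_measure.-integrable `[a, b] (EFin \o cst k).
  apply: continuous_compact_integrable; first exact: segment_compact.
  by apply: continuous_subspaceT => x; exact: cst_continuous.
have gE : EFin \o (fun t => 2 * k * h t - k) =
    (fun t => (2 * k)%:E * (EFin \o h) t - (EFin \o cst k) t)%E.
  by apply/funext => t /=; rewrite EFinB EFinM.
have hZint : lebesgue_measure.-integrable `[a, b]
    (fun t => (2 * k)%:E * (EFin \o h) t)%E.
  by apply: integrableZl => //; exact: hintS.
exists (fun t => 2 * k * h t - k); split.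
- by rewrite gE; exact: integrableB.
- under eq_integral do rewrite EFinB EFinM.
  rewrite integralB//= integralZl//=; last exact: hintS.
  rewrite integral_cst//= lebesgue_measure_itv/= lte_fin ab.
  rewrite -integral_itv_obnd_cbnd; last first.
    by have /integrableP[] := hintS _ (measurable_itv `]a, b]).
  rewrite -hE ?lexx ?ltW//.
  transitivity (2 * k * (F b - F a) - k * (b - a))%:E; first by [].
  congr EFin.
  have := fE b; rewrite IE ?lexx ?ltW// => -> //.
  ring.
- have := @FTC1 R h (BRight a).
  move=> /(_ (fun y => hintS _ (measurable_itv _))).
  have /[swap]/[apply] : locally_integrable setT h.
    by apply: open_integrable_locally => //; exact: openT.
  apply: filterS; first exact: (ae_filter_ringOfSetsType (@lebesgue_measure R)).
  move=> t /= Ht /andP[at' tb].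
  have [dI I'] := Ht at'.
  (* The identity [fE] holds on [[a, b]] only; at an interior point it holds in a neighbourhood,
     which suffices to differentiate it. *)
  apply: (@near_eq_is_derive _ _ _ (fun x => 2 * k * I x - k * (x - a) + f a)).
    near=> x; rewrite (fE x)//; apply/andP; split; apply/ltW.
      by near: x; exact: lt_nbhsr.
    by near: x; exact: lt_nbhsl.
  have dI' : is_derive t 1 I (h t).
    by apply: DeriveDef; [exact: dI|rewrite -derive1E; exact: I'].
  have -> : 2 * k * h t - k = (2 * k) *: h t - k *: (1 - 0) + 0.
    by rewrite /GRing.scale/=; lra.
  apply: (@is_deriveD _ _ _ (fun x => 2 * k * I x - k * (x - a)) (cst (f a))).
Unshelve. all: by end_near. Qed.
(* Measurability is not needed since the integral of a nonnegative function is
   the supremum of the integrals of the simple functions below it. *)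
Lemma le_integral_nonmeasurable d (T : measurableType d) (R : realType)
    (mu : {measure set T -> \bar R}) (D : set T) (f g : T -> \bar R) :
  (forall x, D x -> (f x <= g x)%E) ->
  (\int[mu]_(x in D) f x <= \int[mu]_(x in D) g x)%E.
Proof.
move=> fg.
have fgD x : ((f \_ D) x <= (g \_ D) x)%E.
  by rewrite /patch; case: ifPn => // /set_mem; exact: fg.
rewrite /integral; apply: leeB; apply: le_ereal_sup;
  apply: image_subset => h /= hf x; apply: le_trans (hf x) _.
- by rewrite !funeposE ge_max !le_max fgD lexx !orbT.
- by rewrite !funenegE ge_max !le_max leeN2 fgD lexx !orbT.
Qed.

(** Lowering [f] to [-oo] on a measurable null set changes neither its measurability nor its
    integral, and makes the inequality hold everywhere on [D]. Only [f] is modified: [g] will be a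
    Lagrangian along a trajectory, of unknown measurability. *)
Lemma ae_le_integral_nonmeasurable d (T : measurableType d) (R : realType)
    (mu : {measure set T -> \bar R}) (D : set T) (f g : T -> \bar R) :
  measurable D -> measurable_fun D f ->
  {ae mu, forall x, D x -> (f x <= g x)%E} ->
  (\int[mu]_(x in D) f x <= \int[mu]_(x in D) g x)%E.
Proof.
move=> mD mf [N [mN N0 fgN]].
pose f' x := if x \in N then -oo%E else f x.
have ff' x : ~ N x -> f x = f' x by move=> Nx; rewrite /f' memNset.
rewrite (ae_eq_integral f')//.
- apply: le_integral_nonmeasurable => x Dx; rewrite /f'.
  case: ifPn => [|/negP xN]; first by rewrite leNye.
  by apply: contrapT => fgx; apply: xN; apply/mem_set/fgN => /(_ Dx).
- apply: measurable_fun_if => //.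
  + apply: (@measurable_fun_bool _ _ _ _ true).
    rewrite (_ : _ `&` _ = D `&` N); first exact: measurableI.
    by apply/seteqP; split=> x /= [Dx]; [move/set_mem|move/mem_set].
  + by apply: measurable_funS mf => // x [].
- exists N; split => // x /= nff'; apply: contrapT => Nx; apply: nff' => _.
  exact: ff'.
Qed.

(** * Calculus on a segment *)

Lemma continuous_clamp (R : realType) (a b : R) (f : R -> R) :
  a <= b -> {within `[a, b], continuous f} -> continuous (f \o clamp a b).
Proof.
move=> ab /subspace_continuousP cf x.
have clx : `[a, b]%classic (clamp a b x) by rewrite /= in_itv/= clamp_itv.
have ccl : clamp a b y @[y --> x] --> clamp a b x.
  apply/cvgrPdist_le => e e0; near=> y.
  have : `|x - y| <= e by near: y; exact: cvgr_dist_le.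
  rewrite !ler_norml; have [xy|/ltW yx] := leP x y.
    by have := clamp_le ab xy; lra.
  by have := clamp_le ab yx; lra.
apply: cvg_comp (cf _ clx) => A nA.
have : \forall y \near x, `[a, b]%classic (clamp a b y) -> A (clamp a b y).
  exact: (ccl _ nA).
by apply: filterS => y; apply; rewrite /= in_itv/= clamp_itv.
Unshelve. all: by end_near. Qed.

Lemma itv_is_derive_MVT (R : realType) (f df : R -> R) (a b : R) :
  a <= b -> (forall x, a <= x <= b -> is_derive x (1 : R) f (df x)) ->
  exists2 c, a <= c <= b & f b - f a = df c * (b - a).
Proof.
move=> ab fdf.
have [c cab ->] : exists2 c, c \in `[a, b] & f b - f a = df c * (b - a).
  apply: MVT_segment => //.
    by move=> x; rewrite in_itv/= => /andP[ax xb]; apply: fdf; rewrite !ltW.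
  apply: derivable_within_continuous => x; rewrite in_itv/= => axb.
  by have [] := fdf _ axb.
by exists c; rewrite // -in_itv.
Qed.

Lemma is_derive_lipschitz (R : realType) (f df : R -> R) (a b C : R) :
  (forall x, a <= x <= b -> is_derive x (1 : R) f (df x)) ->
  (forall x, a <= x <= b -> `|df x| <= C) ->
  forall s t, a <= s <= b -> a <= t <= b -> `|f s - f t| <= C * `|s - t|.
Proof.
move=> fdf dfC s t.
wlog st : s t / t <= s.
  move=> wl sab tab; have [|/ltW] := leP t s; first by move=> ?; exact: wl.
  by rewrite distrC (distrC s); move=> ?; exact: wl.
move=> /andP[as_ sb] /andP[at_ tb].
have [x /andP[tx xs]|c /andP[tc cs] ->] := @itv_is_derive_MVT R f df t s st.
  by apply: fdf; rewrite (le_trans at_) // (le_trans xs).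
rewrite normrM ler_wpM2r// dfC//.
by rewrite (le_trans at_) // (le_trans cs).
Qed.

Lemma is_derive_ge0_le (R : realType) (f df : R -> R) (a b : R) :
  (forall x, a <= x <= b -> is_derive x (1 : R) f (df x)) ->
  (forall x, a <= x <= b -> 0 <= df x) ->
  forall s t, a <= s -> s <= t -> t <= b -> f s <= f t.
Proof.
move=> fdf df0 s t as_ st tb.
have [x /andP[sx xt]|c /andP[sc ct]] := @itv_is_derive_MVT R f df s t st.
  by apply: fdf; rewrite (le_trans as_)// (le_trans xt).
rewrite -subr_ge0 => ->; rewrite mulr_ge0 ?subr_ge0// df0//.
by rewrite (le_trans as_)// (le_trans ct).
Qed.

Lemma continuous_antiderivative (R : realType) (f : R -> R) (a : R) :
  continuous f -> exists F : R -> R, forall x, a <= x -> is_derive x (1 : R) F (f x).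
Proof.
(* Starting the integral at [a - 1] makes [a] an interior point, so that the derivative is two-sided
   there too. *)
move=> cf; exists (fun x => \int[lebesgue_measure]_(t in `[a - 1, x]) f t)%R => x ax.
have [||||dF F'] := @continuous_FTC1_closed R f (a - 1) x (x + 1).
- by rewrite ltrDl.
- apply: continuous_compact_integrable; first exact: segment_compact.
  exact: continuous_subspaceT.
- by rewrite (lt_le_trans _ ax)// gtrDl ltrN10.
- exact: cf.
by apply: DeriveDef; [exact: dF|rewrite -derive1E].
Qed.

Lemma continuous_itv_bounded (R : realType) (f : R -> R) (a b : R) :
  {within `[a, b], continuous f} ->
  exists C, forall x, a <= x <= b -> `|f x| <= C.
Proof.
have [ab|ba] := leP a b; last first.
  by exists 0 => x /andP[ax xb]; have := le_trans ax xb; rewrite leNgt ba.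
move=> cf.
have [c _ fc] := EVT_max ab cf.
have [d _ fd] := EVT_min ab cf.
exists (`|f c| + `|f d|) => x axb.
have := fc x; have := fd x; rewrite in_itv/= => /(_ axb) h1 /(_ axb) h2.
have := ler_norm (f c); have := ler_norm (- f d); rewrite normrN => h3 h4.
have := normr_ge0 (f c); have := normr_ge0 (f d) => h5 h6.
rewrite ler_norml; lra.
Qed.

Lemma lipschitz_itvP (R : realType) (a b : R) (f : R -> R) :
  [lipschitz f t | t in `[a, b]] ->
  exists2 k, 0 < k &
    forall s t, a <= s <= b -> a <= t <= b -> `|f s - f t| <= k * `|s - t|.
Proof.
move=> /pinfty_ex_gt0[k k0 lip]; exists k => // s t sab tab.
by have /= := lip (s, t); apply; split; rewrite /= in_itv.
Qed.

Lemma lipschitz_itv_continuous (R : realType) (a b k : R) (f : R -> R) :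
  (forall s t, a <= s <= b -> a <= t <= b -> `|f s - f t| <= k * `|s - t|) ->
  {within `[a, b], continuous f}.
Proof.
move=> lip; apply/subspace_continuousP => x; rewrite /= in_itv/= => xab.
apply/cvgrPdist_le => e e0; rewrite near_withinE.
have k0 : 0 < `|k| + 1 by rewrite ltr_wpDl.
near=> y; rewrite /= in_itv/= => yab.
apply: le_trans (lip _ _ xab yab) _.
have xy : `|x - y| <= e / (`|k| + 1).
  by near: y; apply: cvgr_dist_le; rewrite ?divr_gt0//; exact: cvg_id.
rewrite ler_pdivlMr// in xy; apply: le_trans xy.
by rewrite mulrC ler_wpM2l// (le_trans (ler_norm k))// lerDl.
Unshelve. all: by end_near. Qed.

(** The increment of [z] is the integral of its derivative, which [phi] dominates almost everywhere.
    The derivability of [y] is supplied because [phi] will involve the velocity [derive1 y]. *)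
Lemma lipschitz_le_integral (R : realType) (y z : R -> R) (ky kz T : R)
    (phi : R -> \bar R) :
  0 < T -> 0 < ky -> 0 < kz ->
  (forall s t, 0 <= s <= T -> 0 <= t <= T -> `|y s - y t| <= ky * `|s - t|) ->
  (forall s t, 0 <= s <= T -> 0 <= t <= T -> `|z s - z t| <= kz * `|s - t|) ->
  (forall t d, 0 < t < T -> derivable y t 1 -> is_derive t (1 : R) z d ->
     (d%:E <= phi t)%E) ->
  ((z T - z 0)%:E <= \int[lebesgue_measure]_(t in `[0%R, T]) phi t)%E.
Proof.
move=> T0 ky0 kz0 ylip zlip zphi.
have [g [_ _ dy]] := lipschitz_FTC T0 ky0 ylip.
have [h [hint <- dz]] := lipschitz_FTC T0 kz0 zlip.
apply: ae_le_integral_nonmeasurable => //; first exact: (measurable_int _ hint).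
(* [lipschitz_FTC] gives derivatives at interior times only; the two endpoints are discarded as null
   sets. *)
have aeN (c : R) : {ae lebesgue_measure, forall t : R, t <> c}.
  exists [set c]; split => //=; first by rewrite lebesgue_measure_set1.
  by move=> x /= /contrapT.
have aeF := ae_filter_ringOfSetsType (@lebesgue_measure R).
apply: (@filterS3 _ _ aeF _ _ _ _ _ (@filterI _ _ aeF _ _ dy dz) (aeN 0) (aeN T)).
move=> t [ty tz] /eqP t0 /eqP tT; rewrite /= in_itv/= => /andP[t0' tT'].
have tin : 0 < t < T by rewrite lt_neqAle eq_sym t0 t0' lt_neqAle tT tT'.
by apply: zphi => //; [have [] := ty tin|exact: tz].
Qed.

(** * The cost of a round trip in an edge *)

Lemma le_lagrangian (R : realType) (H : R -> R -> R -> R) (x p v m : R) :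
  ((- (p * v) - H x p m)%:E <= lagrangian H x v m)%E.
Proof. by apply: ereal_sup_ubound; exists p. Qed.

(* Testing the Lagrangian against the momentum [p (y t)] bounds it below by the
   derivative of [K t - P (y t)], where [P] and [K] are primitives. *)
Lemma action_ge (R : realType) (H : R -> R -> R -> R) (m y P p K dK : R -> R)
    (a b T Cp CK : R) :
  trajectory a b T y ->
  (forall x : R, 0 <= x <= 1 -> is_derive x (1 : R) P (p x)) ->
  (forall x : R, 0 <= x <= 1 -> `|p x| <= Cp) ->
  (forall t : R, 0 <= t <= T -> is_derive t (1 : R) K (dK t)) ->
  (forall t, 0 <= t <= T -> `|dK t| <= CK) ->
  (forall t, 0 <= t <= T -> H (y t) (p (y t)) (m (y t)) <= - dK t) ->
  ((K T - K 0 + (P a - P b))%:E <= action H m T y)%E.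
Proof.
move=> [T0 /lipschitz_itvP[k k0 ylip] y01 y0 yT] dP pC dK' KC Hle.
have Plip := is_derive_lipschitz dP pC.
have Klip := is_derive_lipschitz dK' KC.
pose z t := K t - P (y t).
(* [CK] and [Cp] may be any reals; the absolute values and the [+ 1] make the constant positive. *)
have zlip s t : 0 <= s <= T -> 0 <= t <= T ->
    `|z s - z t| <= (`|CK| + `|Cp| * k + 1) * `|s - t|.
  move=> sT tT; rewrite /z (_ : _ - _ = (K s - K t) - (P (y s) - P (y t))); last ring.
  apply: le_trans (ler_normB _ _) _.
  have h1 := Klip _ _ sT tT.
  have h2 := Plip _ _ (y01 _ sT) (y01 _ tT).
  have h3 := ylip _ _ sT tT.
  rewrite !mulrDl -mulrA mul1r -addrA lerD//.
    by rewrite (le_trans h1)// ler_wpM2r// ler_norm.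
  rewrite ler_wpDr//.
  rewrite (le_trans h2)// (@le_trans _ _ (`|Cp| * `|y s - y t|))//.
    by rewrite ler_wpM2r// ler_norm.
  by rewrite ler_wpM2l.
have -> : K T - K 0 + (P a - P b) = z T - z 0 by rewrite /z y0 yT; ring.
apply: (lipschitz_le_integral T0 k0 _ ylip zlip).
  by rewrite ltr_wpDl// addr_ge0// mulr_ge0// ltW.
move=> t d tT dy dz.
have tT' : 0 <= t <= T by case/andP: tT => t0 tT; rewrite !ltW.
have ddy : is_derive t 1 y (derive1 y t) by apply: DeriveDef; rewrite ?derive1E.
have dPy := dP _ (y01 _ tT').
have dKt := dK' _ tT'.
have dzE : d = dK t - p (y t) * derive1 y t.
  have dPyt : is_derive t 1 (P \o y) (p (y t) * derive1 y t).
    exact: is_derive1_comp.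
  have dzt : is_derive t 1 z (dK t - p (y t) * derive1 y t).
    exact: (@is_deriveB _ _ _ K (P \o y)).
  by case: dz => _ <-; case: dzt => _ <-.
apply: le_trans (le_lagrangian _ _ (p (y t)) _ _).
by rewrite lee_fin dzE; have := Hle _ tT'; lra.
Qed.

Section round_trip.
Variables (R : realType) (H : R -> R -> R -> R) (D : set R) (m u : R -> R).
Hypothesis H_continuous : forall x p v : R, 0 <= x <= 1 -> D v ->
  {for (x, p, v), continuous (fun z : R * R * R => H z.1.1 z.1.2 z.2)}.
Hypothesis H_derivable : forall x p v : R, 0 <= x <= 1 -> D v ->
  derivable (H x ^~ v) p 1.
Hypothesis H_convex : forall x v p q s : R, 0 <= x <= 1 -> D v -> 0 <= s <= 1 ->
  H x ((1 - s) * p + s * q) v <= (1 - s) * H x p v + s * H x q v.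
Hypothesis mD : forall x : R, 0 <= x <= 1 -> D (m x).
Hypothesis m_continuous : {within `[0, 1], continuous m}.
Hypothesis u_derivable : forall x : R, 0 <= x <= 1 -> derivable u x 1.
Hypothesis du_continuous : {within `[0, 1], continuous (derive1 u)}.
Hypothesis H_du : forall x : R, 0 <= x <= 1 -> H x (derive1 u x) (m x) = 0.

Let cl := @clamp R 0 1.

Let cl01 x : 0 <= cl x <= 1. Proof. exact: clamp_itv. Qed.

Let cl_id x : 0 <= x <= 1 -> cl x = x. Proof. exact: clamp_id. Qed.

Let du_is_derive (x : R) : 0 <= x <= 1 -> is_derive x (1 : R) u (derive1 u x).
Proof. by move=> x01; apply: DeriveDef; [exact: u_derivable|rewrite derive1E]. Qed.

Let H_cl_continuous (s : R) :
  continuous (fun x => H (cl x) (derive1 u (cl x) + s) (m (cl x))).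
Proof.
move=> x.
have cc := @continuous_clamp R 0 1 _ ler01.
have ccl : cl y @[y --> x] --> cl x.
  by apply: (cc id); apply: continuous_subspaceT => z; exact: cvg_id.
apply: (@continuous_comp _ _ _ (fun x => (cl x, derive1 u (cl x) + s, m (cl x)))
  (fun z : R * R * R => H z.1.1 z.1.2 z.2) x); last first.
  exact: H_continuous (cl01 x) (mD (cl01 x)).
have cm : m (cl y) @[y --> x] --> m (cl x) by exact: (cc m m_continuous).
have cu : derive1 u (cl y) + s @[y --> x] --> derive1 u (cl x) + s.
  by apply: cvgD; [exact: (cc _ du_continuous)|exact: cvg_cst].
exact: (cvg_pair (cvg_pair ccl cu) cm).
Qed.

Let traj_cl_continuous a b (T : R) y : trajectory a b T y ->
  continuous (y \o clamp 0 T).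
Proof.
move=> [T0 /lipschitz_itvP[k _ ylip] _ _ _].
by apply: continuous_clamp (ltW T0) _; exact: lipschitz_itv_continuous ylip.
Qed.

(** The test momentum is [u'] itself, along which the Hamiltonian vanishes, so [K] can be taken to
    be 0. *)
Let action_ge_du a b (T : R) y : trajectory a b T y ->
  ((u a - u b)%:E <= action H m T y)%E.
Proof.
move=> yT; have [C duC] := continuous_itv_bounded du_continuous.
have [_ _ y01 _ _] := yT.
have := @action_ge R H m y u (derive1 u) (cst 0) (cst 0) a b T C 0 yT.
rewrite subrr add0r; apply => //=.
- by move=> t _; rewrite normr0.
- by move=> t tT; rewrite H_du ?oppr0//; exact: y01.
Qed.

(* A momentum [u' + eta] with [H < 0] somewhere and [H <= 0] everywhere strictly
   improves the bound on the total cost of the round trip. *)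
Let round_trip_case1 (T1 T2 : R) y1 y2 (x0 p0 : R) :
  0 <= x0 <= 1 -> H x0 p0 (m x0) < 0 ->
  trajectory 0 1 T1 y1 -> trajectory 1 0 T2 y2 ->
  (0 < action H m T1 y1 + action H m T2 y2)%E.
Proof.
move=> x001 Hx0 traj1 traj2.
pose s0 := p0 - derive1 u x0.
pose kap x := H (cl x) (derive1 u (cl x) + s0) (m (cl x)).
have ckap : continuous kap := @H_cl_continuous s0.
have kap0 : kap x0 < 0 by rewrite /kap cl_id// /s0 addrC subrK.
(* The weight [th] is the negative part of [kap] truncated at 1. It vanishes wherever the full shift
   [s0] makes the Hamiltonian nonnegative, so by convexity the shift [s0 * th] never raises it above
   0. *)
pose th x := clamp 0 1 (- kap x).
have th01 x : 0 <= th x <= 1 by exact: clamp_itv.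
have cth : continuous th.
  move=> x; apply: (@continuous_comp _ _ _ (fun x => - kap x) (clamp 0 1)).
    by apply: cvgN; exact: ckap.
  apply: (@continuous_clamp R 0 1 id ler01).
  by apply: continuous_subspaceT => z; exact: cvg_id.
have thkap x : 0 <= - (th x * kap x).
  rewrite -mulrN; have [k0|k0] := leP 0 (- kap x).
    by rewrite mulr_ge0//; case/andP: (th01 x).
  by rewrite /th /clamp (max_idPl _) ?mul0r// ge_min (ltW k0) orbT.
pose k x := - (th x * kap x).
have ck : continuous k.
  by move=> x; apply: cvgN; apply: cvgM; [exact: cth|exact: ckap].
have k0 : 0 < k x0.
  rewrite /k -mulrN mulr_gt0// ?oppr_gt0//.
  by rewrite /th /clamp lt_max lt_min ltr01 oppr_gt0 kap0 orbT.
have [Th dTh] := continuous_antiderivative 0 cth.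
pose p x := derive1 u x + s0 * th x.
pose P x := u x + s0 * Th x.
have dP (x : R) : 0 <= x <= 1 -> is_derive x (1 : R) P (p x).
  move=> x01; apply: (@is_deriveD _ _ _ u (s0 \*: Th)); first exact: du_is_derive.
  apply: (@is_deriveZ _ _ _ Th); apply: dTh; by case/andP: x01.
have [C pC] : exists C, forall x, 0 <= x <= 1 -> `|p x| <= C.
  have [C duC] := continuous_itv_bounded du_continuous.
  exists (C + `|s0|) => x x01; rewrite (le_trans (ler_normD _ _))// lerD ?duC//.
  rewrite normrM ler_piMr// ger0_norm; by case/andP: (th01 x).
have Hk x : 0 <= x <= 1 -> H x (p x) (m x) <= - k x.
  move=> x01; rewrite /k opprK.
  have := H_convex (derive1 u x) (derive1 u x + s0) x01 (mD x01) (th01 x).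
  rewrite H_du// mulr0 add0r /kap cl_id//; congr (H _ _ _ <= _); rewrite /p; ring.
have cky a b (T : R) y : trajectory a b T y -> continuous (k \o (y \o clamp 0 T)).
  move=> traj t; apply: continuous_comp; [exact: (traj_cl_continuous traj)|exact: ck].
have bound a b (T : R) y : trajectory a b T y -> exists K : R -> R,
    [/\ (forall t : R, 0 <= t <= T -> is_derive t (1 : R) K (k (y t))),
        K 0 <= K T &
        ((K T - K 0 + (P a - P b))%:E <= action H m T y)%E].
  move=> traj; have [T0 ylip y01 _ _] := traj.
  have [K dK] := continuous_antiderivative 0 (cky _ _ _ _ traj).
  exists K.
  have dK' (t : R) : 0 <= t <= T -> is_derive t (1 : R) K (k (y t)).
    move=> tT; have := dK t; rewrite /= clamp_id//; apply; by case/andP: tT.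
  split=> //.
    by apply: (is_derive_ge0_le dK') => //; [move=> x _; exact: thkap|exact: ltW].
  have [CK kC] : exists C, forall x, 0 <= x <= 1 -> `|k x| <= C.
    by apply: continuous_itv_bounded; exact: continuous_subspaceT.
  apply: (action_ge traj dP pC dK') => t tT; first by apply: kC; exact: y01.
  exact/Hk/y01.
have [K1 [dK1 K1le K1a]] := bound _ _ _ _ traj1.
have [K2 [dK2 K2le K2a]] := bound _ _ _ _ traj2.
apply: lt_le_trans (leeD K1a K2a); rewrite -EFinD lte_fin.
(* The terms in [P] cancel over the round trip and neither gain is negative, so a strict gain on the
   way out is enough. *)
suff : K1 0 < K1 T1 by lra.
rewrite lt_neqAle K1le andbT; apply/eqP => K1E.
have [T0 ylip y01 y10 y1T] := traj1.
(* Without a gain, the nondecreasing [K1] is constant and [k] vanishes along the way out. But this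
   way passes through [x0], where [k] is positive. *)
have K1cst t : 0 <= t <= T1 -> K1 t = K1 0.
  move=> /andP[t0 tT]; apply/le_anti/andP; split.
    rewrite K1E; apply: (is_derive_ge0_le dK1) => //; move=> x _; exact: thkap.
  by apply: (is_derive_ge0_le dK1) => //; move=> x _; exact: thkap.
pose g := k \o (y1 \o clamp 0 T1).
have cg : continuous g by exact: cky traj1.
have g0 t : 0 < t < T1 -> g t = 0.
  move=> tT; have tT' : 0 <= t <= T1 by case/andP: tT => ? ?; rewrite !ltW.
  rewrite /g/= clamp_id//.
  have [_ <-] := dK1 _ tT'.
  have -> : 'D_1 K1 t = 'D_1 (cst (K1 0)) t.
    apply: near_eq_derive; near=> s; rewrite K1cst//; apply/andP; split; apply/ltW.
      by near: s; apply: lt_nbhsr; case/andP: tT.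
    by near: s; apply: lt_nbhsl; case/andP: tT.
  exact: derive_cst.
have [t0 t0T yt0] : exists2 t, t \in `[0, T1] & y1 t = x0.
  have [k' _ ylip'] := lipschitz_itvP ylip.
  apply: IVT; [exact: ltW|exact: lipschitz_itv_continuous ylip'|].
  by rewrite y10 y1T (min_idPl ler01) (max_idPr ler01).
move: t0T; rewrite in_itv/= => t0T.
have : 0 < g t0 by rewrite /g/= clamp_id// yt0.
move=> gt0.
have : \forall t \near t0, 0 < g t by exact: (cvgr_gt (g t0) (cg t0)).
(* [t0] may be an endpoint, which [g0] does not cover. Moving it by the fraction [s] towards the
   midpoint [T1 / 2] gives an interior time at distance less than [e]. *)
move=> /nbhs_ballP[e /= e0 eg].
pose s := Num.min 1 (e / T1).
have s0' : 0 < s by rewrite lt_min ltr01 divr_gt0.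
have s1 : s <= 1 by rewrite ge_min lexx.
have sT : s * T1 <= e by rewrite -ler_pdivlMr// ge_min lexx orbT.
have /andP[t00 t0T'] := t0T.
pose t1 := t0 + s * (T1 / 2 - t0).
have t1T : 0 < t1 < T1.
  by rewrite /t1; apply/andP; split; nra.
have : ball t0 e t1.
  rewrite /ball/= /t1 opprD addrA subrr add0r normrN normrM gtr0_norm//.
  apply: (@le_lt_trans _ _ (s * (T1 / 2))).
    by apply: ler_wpM2l; [exact: ltW|rewrite ler_norml; lra].
  by apply: lt_le_trans sT; rewrite ltr_pM2l// ltr_pdivrMr//; lra.
by move=> /eg; rewrite g0// ltxx.
Unshelve. all: by end_near. Qed.

(** Since [H] is nonnegative and vanishes at [u'], its derivative in the momentum is 0 there, and
    difference quotients for small negative increments are below [e] in absolute value. *)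
Let small_slope (e x : R) : (forall x p, 0 <= x <= 1 -> 0 <= H x p (m x)) ->
  0 < e -> 0 <= x <= 1 ->
  exists2 c, 0 < c & H x (derive1 u x - c) (m x) < e * c.
Proof.
move=> H_ge0 e0 x01; set p := derive1 u x.
have dH : is_derive p 1 (H x ^~ (m x)) 0.
  apply: (@derive1_at_min _ _ (p - 1) (p + 1)); first by lra.
  - by move=> q _; exact: H_derivable x01 (mD x01).
  - by rewrite in_itv/=; apply/andP; split; lra.
  - by move=> q _; rewrite H_du// H_ge0.
have [+ dH0] := dH; rewrite /derivable => /cvg_ex[/= l dl].
have l0 : l = 0 by rewrite -dH0; apply/esym/cvg_lim.
move: dl; rewrite l0 => /cvgrPdist_lt/(_ _ e0) nearl.
move: nearl => /nbhs_ballP[r /= r0 hr].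
pose c := r / 2; have c0 : 0 < c by rewrite divr_gt0.
have cr : ball 0 r (- c).
  by rewrite /ball/= sub0r opprK gtr0_norm// ltr_pdivrMr//; lra.
have cN0 : - c != 0 by rewrite oppr_eq0 gt_eqF.
exists c => //; have := hr _ cr cN0.
rewrite sub0r normrN -/p H_du// subr0 [_%:A]mulr1 (addrC (- c)).
rewrite /GRing.scale/= normrM normfV normrN (gtr0_norm c0).
by rewrite (ger0_norm (H_ge0 _ _ x01)) mulrC ltr_pdivrMr.
Qed.

(* Here [u'] minimizes [H], so lowering the momentum by a small constant [c] on
   the way out changes the bound by [c] to first order, while [H] only
   contributes [o(c)]; compactness makes this uniform. *)
Let round_trip_case2 (T1 T2 : R) y1 y2 :
  (forall x p, 0 <= x <= 1 -> 0 <= H x p (m x)) ->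
  trajectory 0 1 T1 y1 -> trajectory 1 0 T2 y2 ->
  (0 < action H m T1 y1 + action H m T2 y2)%E.
Proof.
move=> H_ge0 traj1 traj2.
have [T0 _ y01 _ _] := traj1.
(* With this slope the loss [e * c * T1] is [c / 2], half of the gain [c]. *)
pose e := (2 * T1)^-1.
have e0 : 0 < e by rewrite invr_gt0; lra.
have : \forall c \near (0 : R)^'+, `[(0 : R), 1] `<=`
    [set x | H (cl x) (derive1 u (cl x) - c) (m (cl x)) <= e * c].
  have /compact_near_coveringP := @segment_compact R 0 1; apply => x.
  rewrite /= in_itv/= => x01.
  have [c c0 Hc] := small_slope H_ge0 e0 x01.
  near=> x' c'; rewrite /=.
  have c'0 : 0 < c' by near: c'; exact: nbhs_right_gt.
  have c'c : c' <= c by near: c'; exact: nbhs_right_le.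
  have Hc' : H (cl x') (derive1 u (cl x') - c) (m (cl x')) < e * c.
    near: x'; apply: (cvgr_lt _ (H_cl_continuous (s := - c) (x := x))).
    by rewrite cl_id.
  (* Continuity has carried the bound for [c] to nearby points; convexity, with the value 0 at [u'],
     carries it to every smaller [c']. *)
  have s01 : 0 <= c' / c <= 1.
    by rewrite divr_ge0 ?(ltW c0) ?(ltW c'0)//= ler_pdivrMr// mul1r.
  have := H_convex (derive1 u (cl x')) (derive1 u (cl x') - c) (cl01 x')
    (mD (cl01 x')) s01.
  rewrite H_du// mulr0 add0r.
  have -> : (1 - c' / c) * derive1 u (cl x')
      + c' / c * (derive1 u (cl x') - c) = derive1 u (cl x') - c'.
    by field; rewrite gt_eqF.
  move=> /le_trans; apply.
  have -> : e * c' = c' / c * (e * c) by field; rewrite gt_eqF.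
  by rewrite ler_wpM2l ?(ltW Hc')//; case/andP: s01.
move=> nearc.
have [c [c0 Hc]] : exists c, 0 < c /\ `[(0 : R), 1] `<=`
    [set x | H (cl x) (derive1 u (cl x) - c) (m (cl x)) <= e * c].
  apply: (@filter_ex _ ((0 : R)^'+)).
  by apply: filterI => //; exact: nbhs_right_gt.
have [C duC] := continuous_itv_bounded du_continuous.
have dP (x : R) : 0 <= x <= 1 ->
    is_derive x (1 : R) (fun x => u x - c * x) (derive1 u x - c).
  move=> x01; have dux := du_is_derive x01.
  rewrite -[X in _ - X]mulr1; exact: (@is_deriveB _ _ _ u (c \*: (@id R))).
have dK (t : R) : 0 <= t <= T1 ->
    is_derive t (1 : R) (fun t => - (e * c) * t) (- (e * c)).
  move=> _; rewrite -[X in is_derive _ _ _ X]mulr1.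
  exact: (@is_deriveZ _ _ _ (@id R)).
have A1 := @action_ge _ H m y1 _ _ _ _ 0 1 T1 (C + c) (e * c) traj1 dP.
have /= {A1} := A1 _ _ _ dK.
have A2 := action_ge_du traj2.
move=> A1; have {A1} : ((- (e * c) * T1 - - (e * c) * 0
    + (u 0 - c * 0 - (u 1 - c * 1)))%:E <= action H m T1 y1)%E.
  apply: A1.
  - move=> x x01; rewrite (le_trans (ler_normB _ _))// lerD ?duC//.
    by rewrite gtr0_norm.
  - by move=> t _; rewrite normrN gtr0_norm// mulr_gt0.
  - move=> t tT; rewrite opprK; have := Hc (y1 t).
    by rewrite /= in_itv/= cl_id ?y01//; apply.
move=> A1; apply: lt_le_trans (leeD A1 A2); rewrite -EFinD lte_fin.
have eT : e * T1 = 2^-1 by rewrite /e; field; rewrite gt_eqF.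
have -> : - (e * c) * T1 - - (e * c) * 0 + (u 0 - c * 0 - (u 1 - c * 1))
  + (u 1 - u 0) = c - c * (e * T1) by ring.
rewrite eT; lra.
Unshelve. all: by end_near. Qed.

Lemma round_trip_action_gt0 (T1 T2 : R) y1 y2 :
  trajectory 0 1 T1 y1 -> trajectory 1 0 T2 y2 ->
  (0 < action H m T1 y1 + action H m T2 y2)%E.
Proof.
move=> traj1 traj2.
have [[x0 [p0 [x001 Hx0]]]|Hge0] :=
  pselect (exists x0 p0, 0 <= x0 <= 1 /\ H x0 p0 (m x0) < 0).
  exact: round_trip_case1 x001 Hx0 traj1 traj2.
apply: round_trip_case2 traj1 traj2 => x p x01.
by rewrite leNgt; apply/negP => Hx; apply: Hge0; exists x, p.
Qed.

End round_trip.

Lemma derivable_middle (R : realType) (f : R * R * R -> R) (x p v : R) :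
  derivable f (x, p, v) (0, 1, 0) -> derivable (fun q => f (x, q, v)) p 1.
Proof.
rewrite /derivable.
set g := (X in cvg (X @ _) -> _); set h := (X in _ -> cvg (X @ _)).
suff -> : g = h by [].
apply/funext => s; rewrite /g /h /=; congr (_ *: (f _ - _)).
have -> : s *: ((0, 1, 0) : R * R * R) + (x, p, v)
  = (s * 0 + x, s * 1 + p, s * 0 + v) by [].
by rewrite !mulr0 !add0r.
Qed.

Lemma convex_functionE (R : realType) (f : R -> R) (p q s : R) :
  convex_function [set: R^o] f -> 0 <= s <= 1 ->
  f ((1 - s) * p + s * q) <= (1 - s) * f p + s * f q.
Proof.
move=> cf /andP[s0 s1].
have := @cf (Itv01 s0 s1) q p; rewrite !inE => /(_ Logic.I Logic.I).
by rewrite convRE addrC (addrC ((1 - s) * p)).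
Qed.

(** In extended reals [-oo + +oo] is [-oo]. *)
Lemma adde_gt0_gtNy (R : realDomainType) (x y : \bar R) :
  (0 < x + y)%E -> (-oo < x)%E.
Proof. by case: x => [r||]; rewrite ?ltNyr// addNye. Qed.

Lemma opp_halfK (E : finType) : involutive (@opp_half E).
Proof. by case=> k b; rewrite /opp_half/= negbK. Qed.

(** * Positivity of round trips and lower bounds on the costs *)

Section travel_costs.
Variables (R : realType) (V E : finType) (M : mfg_data R V E).
Hypothesis M_model : mfg_model M.
Implicit Types h : half_edge E.

(** On an original edge both minima are attained, for the same density, and [round_trip_action_gt0]
    applies to the minimizers. On an auxiliary edge one direction costs [+oo] and the other a real
    number. *)
Lemma travel_cost_round_trip_gt0 h (j : R) :
  (0 < travel_cost M h j + travel_cost M (opp_half h) j)%E.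
Proof.
wlog h2 : h / h.2 = true.
  move=> wl; case: h => k [|]; first exact: wl.
  by rewrite addeC; have := wl (k, true); rewrite /opp_half/=; apply.
case: h h2 => k b /= ->; rewrite /opp_half/=.
have [kO|kE|kX] : [\/ kind M k = Original, kind M k = AuxEntrance
  | kind M k = AuxExit] by case: (kind M k); [constructor 1|constructor 2|constructor 3].
- have [T1 [y1 [traj1 c1]]] := travel_cost_min M_model (h := (k, true)) kO j.
  have [T2 [y2 [traj2 c2]]] := travel_cost_min M_model (h := (k, false)) kO j.
  have [mD [u [du cdu cm Hdu _]]] := density_system M_model kO j.
  have [U [oU DU smU]] := hamiltonian_smooth M_model kO.
  have conv := hamiltonian_convex M_model kO.
  have Uz x p v : 0 <= x <= 1 -> density_range M k v -> U (x, p, v).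
    by move=> x01 Dv; exact: DU.
  rewrite c1 c2; apply: (@round_trip_action_gt0 R _ (density_range M k) _ u) => //.
  + move=> x p v x01 Dv.
    by have [] := smU [::] (x, p, v) (Uz _ _ _ x01 Dv).
  + move=> x p v x01 Dv.
    have [_ dH] := smU [::] (x, p, v) (Uz _ _ _ x01 Dv).
    exact: (derivable_middle (dH (0, 1, 0))).
  + by move=> x v p q s x01 Dv s01; apply: convex_functionE (conv _ _ x01 Dv) s01.
- have [b' [ent nent]] := aux_entranceP M_model kE.
  rewrite /travel_cost/= kE; move: ent nent; rewrite inE negb_or.
  by case: b' => /= -> /andP[/negbTE -> _]; rewrite ?adde0 ?add0e ltry.
- have [b' [ent nent]] := aux_exitP M_model kX.
  rewrite /travel_cost/= kX; move: ent nent; rewrite inE negb_or.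
  by case: b' => /= -> /andP[_ /negbTE ->]; rewrite ?addey ?addye ?ltry.
Qed.

Lemma travel_cost_gtNy h (j : R) : (-oo < travel_cost M h j)%E.
Proof. exact: adde_gt0_gtNy (travel_cost_round_trip_gt0 h j). Qed.

Lemma switching_gtNy h h' : switchable M h h' -> (-oo < switching M h h')%E.
Proof.
move=> /(switchingP M_model); rewrite ltNye.
by case: (kind M h.1) (kind M h'.1) => -[] => [/fin_numP[]||->|->|||->||] // ->.
Qed.

Lemma wardrop_cost_gtNy (js : darc E -> R) a :
  is_arc M a -> (-oo < wardrop_cost M js a)%E.
Proof.
case: a => [h|[h h']] /and3P[sw _ _]; first exact: travel_cost_gtNy.
exact: switching_gtNy.
Qed.

End travel_costs.

(** * Walks and equilibria *)

Section walks.
Variables (R : realType) (V E : finType) (M : mfg_data R V E).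
Implicit Types (h : half_edge E) (a : darc E) (s : seq (darc E)).

(** The competitors of positive walks: their arcs need not carry current. *)
Fixpoint arc_walk h s h' : Prop :=
  match s with
  | [::] => h = h'
  | a :: s' => [/\ is_arc M a, source a = h & arc_walk (target a) s' h']
  end.

Lemma positive_arc_walk (j : darc E -> R) h s h' :
  positive_walk M j h s h' -> arc_walk h s h'.
Proof. by elim: s h => //= a s IH h [? _ ? /IH]. Qed.

Lemma arc_walk_is_arc h s h' a : arc_walk h s h' -> a \in s -> is_arc M a.
Proof.
elim: s h => //= b s IH h [arcb _ /IH ws]; rewrite in_cons => /predU1P[->//|].
exact: ws.
Qed.

(** The contributions of consecutive arcs telescope: as a current, a walk obeys Kirchhoff's law
    except at its two ends. This is what keeps a rerouted current admissible. *)
Lemma arc_walk_balance h s h' h0 : arc_walk h s h' ->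
  \sum_(a | is_arc M a && (source a == h0)) (count_mem a s)%:R
  - \sum_(a | is_arc M a && (target a == h0)) (count_mem a s)%:R
  = (h == h0)%:R - (h' == h0)%:R :> R.
Proof.
elim: s h => [h /= ->|b s IH h /= [arcb <- /IH]].
  by rewrite !big1 ?subrr.
under [in X in _ -> X = _]eq_bigr do rewrite natrD.
under [in X in _ -> _ - X = _]eq_bigr do rewrite natrD.
rewrite !big_split/=.
have delta (P : pred (darc E)) : \sum_(a | P a) (b == a)%:R = (P b)%:R :> R.
  have [Pb|Pb] := boolP (P b).
    rewrite (bigD1 b)//= eqxx big1 ?addr0// => a /andP[_ /negbTE].
    by rewrite eq_sym => ->.
  by rewrite big1// => a Pa; case: eqP Pb => // ->; rewrite Pa.
rewrite (delta (fun a => is_arc M a && (source a == h0))).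
rewrite (delta (fun a => is_arc M a && (target a == h0))).
rewrite arcb/=; lra.
Qed.

Lemma positive_walk_bound (j : darc E -> R) h s h' : positive_walk M j h s h' ->
  exists2 d, 0 < d & forall a, a \in s -> d <= j a.
Proof.
elim: s h => [h _|b s IH h /= [_ jb _ /IH[d d0 dj]]]; first by exists 1.
exists (Num.min d (j b)); first by rewrite lt_min d0.
move=> a; rewrite in_cons ge_min => /predU1P[->|/dj ->//].
by rewrite lexx orbT.
Qed.

Lemma big_count (f : darc E -> R) s :
  \sum_a f a * (count_mem a s)%:R = \sum_(a <- s) f a.
Proof.
elim: s => [|b s IH]; first by rewrite big_nil big1// => a _; rewrite mulr0.
rewrite big_cons -IH (bigD1 b)//= [in RHS](bigD1 b)//= eqxx natrD mulrDr mulr1.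
rewrite addrA; congr (_ + _); apply: eq_bigr => a /negbTE.
by rewrite eq_sym => ->.
Qed.

End walks.

(** * Comparison of walks at equilibrium *)

Section equilibrium.
Variables (R : realType) (V E : finType) (M : mfg_data R V E) (js : darc E -> R).
Hypothesis M_model : mfg_model M.
Hypothesis js_equilibrium : wardrop_equilibrium M js.
Implicit Types (h : half_edge E) (a : darc E) (s : seq (darc E)).

Let cost := wardrop_cost M js.

(** As no arc costs [-oo], a single arc of cost [+oo] would make the whole sum infinite. *)
Lemma walk_cost_fin h s h' : arc_walk M h s h' ->
  (\sum_(a <- s) cost a < +oo)%E -> forall a, a \in s -> cost a \is a fin_num.
Proof.
elim: s h => //= b s IH h [arcb _ ws]; rewrite big_cons => soo a.
have bNy := wardrop_cost_gtNy M_model js arcb.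
have sNy : (-oo < \sum_(a <- s) cost a)%E.
  rewrite big_seq; elim/big_ind: _ => [|x y xNy yNy|c cs]; first exact: ltNyr.
    by rewrite ltNye adde_eq_ninfty negb_or -!ltNye xNy.
  exact/wardrop_cost_gtNy/(arc_walk_is_arc ws).
have /andP[by_ sy] : (cost b < +oo)%E && (\sum_(a <- s) cost a < +oo)%E.
  move: soo bNy sNy; rewrite -/(cost b).
  by case: (cost b) (\sum_(a <- s) cost a)%E => [x||] [y||]; rewrite ?ltry.
rewrite in_cons => /predU1P[->|]; last exact: IH ws sy _.
by rewrite fin_real// bNy.
Qed.

(* Rerouting a small amount of current from [s1] to [s2] is admissible, so it
   cannot decrease the cost. *)
Lemma equilibrium_walk_le h s1 h1 s2 h2 :
  positive_walk M js h s1 h1 -> arc_walk M h s2 h2 ->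
  h1 = h2 \/ vert M h1 \in exit M /\ vert M h2 \in exit M ->
  (\sum_(a <- s1) cost a <= \sum_(a <- s2) cost a)%E.
Proof.
move=> pos1 ws2 h12; have ws1 := positive_arc_walk pos1.
have [[js0 jsN jsK] js_opt] := js_equilibrium.
have [s2oo|] := ltP (\sum_(a <- s2) cost a)%E +oo%E; last first.
  by rewrite leye_eq => /eqP ->; rewrite leey.
have fin2 := walk_cost_fin ws2 s2oo.
have [d d0 dj] := positive_walk_bound pos1.
(* An arc occurs at most [size s1] times in [s1], so removing [e] per occurrence takes at most [d]
   from its current; the successor covers the empty walk. *)
pose e := d / (size s1).+1%:R; have e0 : 0 < e by rewrite divr_gt0.
pose c1 a : R := (count_mem a s1)%:R; pose c2 a : R := (count_mem a s2)%:R.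
pose j a := js a + e * (c2 a - c1 a).
have c0 h' s h'' a : arc_walk M h' s h'' -> ~~ is_arc M a ->
    (count_mem a s)%:R = 0 :> R.
  move=> ws aN; rewrite (count_memPn _)//; apply: contra aN.
  exact: arc_walk_is_arc ws.
have j_adm : admissible M j.
  split=> [a arca|a arca|h0 h0N].
  - have c2ge : 0 <= e * c2 a by rewrite mulr_ge0// ltW.
    rewrite /j mulrBr.
    suff : e * c1 a <= js a by lra.
    have [as1|as1] := boolP (a \in s1); last first.
      by rewrite /c1 (count_memPn as1) mulr0 js0.
    apply: le_trans (dj _ as1); rewrite /e -mulrA ler_piMr ?(ltW d0)//.
    rewrite mulrC ler_pdivrMr// mul1r ler_nat.
    exact: leq_trans (count_size _ _) (leqnSn _).
  - by rewrite /j /c1 /c2 jsN// (c0 _ _ _ _ ws1)// (c0 _ _ _ _ ws2)// subrr mulr0 addr0.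
  - rewrite -(jsK _ h0N) /j !big_split/= -!mulr_sumr !sumrB.
    have := arc_walk_balance h0 ws1; have := arc_walk_balance h0 ws2.
    rewrite -/c1 -/c2.
    (* Kirchhoff's law is imposed away from the exits, so it does not distinguish two exit ends. *)
    have -> : (h1 == h0) = (h2 == h0).
      case: h12 => [->//|[ex1 ex2]]; apply/eqP/eqP => heq; move: h0N.
        by rewrite -heq ex1.
      by rewrite -heq ex2.
    nra.
have jE a : (js a - j a)%:E = (e * (c1 a - c2 a))%:E.
  by congr EFin; rewrite /j; ring.
have costy a : is_arc M a -> cost a \isn't a fin_num -> cost a = +oo%E /\ c2 a = 0.
  move=> arca aN; split; last first.
    by rewrite /c2 (count_memPn _)//; apply: contra aN; exact: fin2.
  have := wardrop_cost_gtNy M_model js arca; move: aN; rewrite -/(cost a).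
  by case: (cost a).
have js_le := js_opt _ j_adm.
(* An arc of infinite cost in [s1] would lose current in [j] and contribute [+oo] to the equilibrium
   inequality, where no other term is [-oo]. *)
have fin1 a : a \in s1 -> cost a \is a fin_num.
  move=> as1; have arca := arc_walk_is_arc ws1 as1.
  apply: contraT => /(costy _ arca)[ay c2a]; move: js_le.
  rewrite (bigD1 a)//= jE c2a subr0 -/(cost a) ay gt0_mulye; last first.
    by rewrite lte_fin mulr_gt0// /c1 ltr0n -has_count has_pred1.
  rewrite addye//; elim/big_ind: _ => // [x y xNy yNy|b /andP[arcb _]].
    by rewrite adde_eq_ninfty negb_or xNy.
  rewrite jE -/(cost b).
  have [bfin|/(costy _ arcb)[-> ->]] := boolP (cost b \is a fin_num).
    by rewrite -(fineK bfin) -EFinM.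
  by rewrite subr0 gt_eqF// (lt_le_trans (ltNyr 0))// mule_ge0// lee_fin mulr_ge0// ltW.
pose fc a := fine (cost a).
have sumE s : (forall a, a \in s -> cost a \is a fin_num) ->
    (\sum_(a <- s) cost a)%E = (\sum_(a <- s) fc a)%:E.
  by move=> fins; rewrite -sumEFin; apply: eq_big_seq => a /fins /fineK.
rewrite !sumE// lee_fin -subr_le0 -(pmulr_rle0 _ e0).
move: js_le; rewrite (eq_bigr (fun a => (e * (fc a * c1 a - fc a * c2 a))%:E)).
  rewrite sumEFin lee_fin -(big_count fc s1) -(big_count fc s2) -sumrB mulr_sumr.
  move=> /(le_trans _); apply.
  rewrite [leRHS]big_mkcond/=; apply: ler_sum => a _; case: ifPn => [_|aN].
    by rewrite mulrBr.
  by rewrite (c0 _ _ _ _ ws1)// (c0 _ _ _ _ ws2)// !mulr0 subrr mulr0.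
move=> a arca; rewrite jE -/(cost a).
(* An arc of infinite cost is now on neither walk and contributes [+oo * 0 = 0]. *)
have [afin|/[dup] aN /(costy _ arca)[_ c2a]] := boolP (cost a \is a fin_num).
  by rewrite -[in LHS](fineK afin) -EFinM; congr EFin; rewrite /fc; ring.
have c1a : c1 a = 0.
  by rewrite /c1 (count_memPn _)//; apply: contra aN; exact: fin1.
by rewrite c1a c2a subrr !mulr0 mule0 subrr mulr0.
Qed.

Variable u : half_edge E -> R.
Hypothesis all_regular : forall h, regular M js h.
Hypothesis u_value : wardrop_value M js u.

(** No arc leaves an exit, so the walk defining the value there is empty. *)
Lemma value_exit h : vert M h \in exit M -> u h = 0.
Proof.
move=> hex; have [s [h' [ws _ uE]]] := u_value (all_regular h).
case: s ws uE => [_|a s [arca _ ah _]]; first by rewrite big_nil => -[].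
by move: arca; rewrite /is_arc ah hex !andbF.
Qed.

(** The arc followed by the walk that defines the value at its target competes with the walk that
    defines the value at its source. *)
Lemma value_le_cost a : is_arc M a ->
  ((u (source a))%:E <= cost a + (u (target a))%:E)%E.
Proof.
move=> arca.
have [s1 [h1 [ws1 ex1 ->]]] := u_value (all_regular (source a)).
have [s2 [h2 [ws2 ex2 ->]]] := u_value (all_regular (target a)).
have := @equilibrium_walk_le (source a) s1 h1 (a :: s2) h2 ws1.
rewrite big_cons; apply; last by right.
by split => //; exact: positive_arc_walk ws2.
Qed.

(** With current on the arc, the competing walk is itself positive, and the comparison also holds in
    the other direction. *)
Lemma value_eq_cost a : is_arc M a -> 0 < js a ->
  (u (source a))%:E = (cost a + (u (target a))%:E)%E.
Proof.
move=> arca ja; apply/le_anti; rewrite value_le_cost//=.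
have [s1 [h1 [ws1 ex1 ->]]] := u_value (all_regular (source a)).
have [s2 [h2 [ws2 ex2 ->]]] := u_value (all_regular (target a)).
have := @equilibrium_walk_le (source a) (a :: s2) h2 s1 h1.
rewrite big_cons; apply; [by []|exact: positive_arc_walk ws1|by right].
Qed.

Lemma value_cost_fin a : is_arc M a -> 0 < js a -> cost a \is a fin_num.
Proof.
by move=> arca /(value_eq_cost arca); case: (cost a).
Qed.

End equilibrium.

(** * The MFG equations *)

Section network_topology.
Variables (R : realType) (V E : finType) (M : mfg_data R V E).
Implicit Types h : half_edge E.

Lemma switchable_sym h h' : switchable M h h' = switchable M h' h.
Proof. by rewrite /switchable eq_sym [in RHS]eq_sym; congr (_ && _); rewrite eq_sym. Qed.

(** A transition would give the vertex a second half-edge, against incidence 1. *)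
Lemma boundary_not_switchable h h' :
  vert M h \in entrance M :|: exit M -> ~~ switchable M h h'.
Proof.
move=> hb; apply/negP => /andP[hh' /eqP vhh'].
have := boundary_incidence hb; apply/eqP; rewrite gtn_eqF//.
apply: (@leq_trans #|[set h; h']%SET|).
  by rewrite cards2 (_ : h != h')//; apply: contraNneq hh' => ->.
apply/subset_leq_card/fintype.subsetP => x.
by rewrite !inE => /orP[]/eqP->; rewrite ?vhh'.
Qed.

Lemma half_edge_vert_inj h h' :
  h.1 = h'.1 -> vert M h = vert M h' -> h = h'.
Proof.
case: h h' => [k b] [k' b'] /= <-; case: b b' => -[] // vE;
  by have := vert_neq M k; rewrite vE eqxx.
Qed.

(** The deletion concerns boundary vertices only, which carry no transitions. *)
Lemma transition_is_arc h h' : switchable M h h' -> is_arc M (Transition h h').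
Proof.
move=> sw; rewrite /is_arc/= sw/=.
have hN : vert M h \notin entrance M :|: exit M.
  by apply: contraTN sw => /boundary_not_switchable.
have h'N : vert M h' \notin entrance M :|: exit M.
  by rewrite switchable_sym in sw; apply: contraTN sw => /boundary_not_switchable.
by move: hN h'N; rewrite !inE !negb_or => /andP[_ ->] /andP[-> _].
Qed.

Lemma sum_arcs (j : darc E -> R) (P : pred (darc E)) :
  (forall a, ~~ is_arc M a -> j a = 0) ->
  \sum_(a | is_arc M a && P a) j a = \sum_(a | P a) j a.
Proof.
move=> jN; rewrite [LHS]big_mkcond [RHS]big_mkcond; apply: eq_bigr => a _.
by have [//|/jN->] := boolP (is_arc M a); rewrite if_same.
Qed.

Lemma sum_arcs_source (j : darc E -> R) h :
  (forall a, ~~ is_arc M a -> j a = 0) ->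
  \sum_(a | is_arc M a && (source a == h)) j a
  = j (Travel (opp_half h)) + \sum_(h' | switchable M h h') j (Transition h h').
Proof.
move=> jN; rewrite sum_arcs// big_sumType/=; congr (_ + _).
  rewrite (big_pred1 (opp_half h))// => h'.
  by rewrite /= (can2_eq (@opp_halfK E) (@opp_halfK E)).
rewrite (reindex_onto (fun h' => (h, h')) snd) /=; last first.
  by move=> [h1 h2] /= /eqP ->.
rewrite [LHS]big_mkcond [RHS]big_mkcond; apply: eq_bigr => h' _.
rewrite !eqxx/=; case: ifPn => // sw.
by rewrite jN// /is_arc (negbTE sw).
Qed.

Lemma sum_arcs_target (j : darc E -> R) h :
  (forall a, ~~ is_arc M a -> j a = 0) ->
  \sum_(a | is_arc M a && (target a == h)) j a
  = j (Travel h) + \sum_(h' | switchable M h h') j (Transition h' h).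
Proof.
move=> jN; rewrite sum_arcs// big_sumType/=; congr (_ + _).
  by rewrite (big_pred1 h).
rewrite (reindex_onto (fun h' => (h', h)) fst) /=; last first.
  by move=> [h1 h2] /= /eqP ->.
rewrite [LHS]big_mkcond [RHS]big_mkcond; apply: eq_bigr => h' _.
rewrite !eqxx/= switchable_sym; case: ifPn => // sw.
by rewrite jN// /is_arc (negbTE sw).
Qed.

End network_topology.

Theorem theorem6p7 (R : realType) (V E : finType) (M : mfg_data R V E)
    (M_model : mfg_model M) (M_strict : strict_switching M)
    (js : darc E -> R) (js_equilibrium : wardrop_equilibrium M js)
    (all_regular : forall h : half_edge E, regular M js h)
    (u : half_edge E -> R) (u_value : wardrop_value M js u) :
  mfg_equations M (edge_current js) (transition_current js) u.
Proof.
have [[js0 jsN jsK] _] := js_equilibrium.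
have js_ge0 a : 0 <= js a.
  by have [/js0//|/jsN->] := boolP (is_arc M a).
have js_gt0 a : js a != 0 -> is_arc M a /\ 0 < js a.
  move=> ja; split; last by rewrite lt_neqAle eq_sym ja js_ge0.
  by apply: contraNT ja => /jsN ->.
(* [signed] undoes the orientation, so both travel arcs of an edge have their costs at the same
   current. *)
have netE h : wardrop_cost M js (Travel h)
    = travel_cost M h (js (Travel (h.1, true)) - js (Travel (h.1, false))).
  by case: h => k []; rewrite /= /signed/= ?opprB.
have le_arc := value_le_cost M_model js_equilibrium all_regular u_value.
have eq_arc := value_eq_cost M_model js_equilibrium all_regular u_value.
have fin_arc := value_cost_fin M_model js_equilibrium all_regular u_value.
have u_exit := value_exit all_regular u_value.
(* A positive cycle is compared with the empty walk. *)
have pos_cycle h s : positive_walk M js h s h ->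
    (\sum_(a <- s) wardrop_cost M js a <= 0)%E.
  move=> pos; have := equilibrium_walk_le M_model js_equilibrium (s2 := [::]) pos.
  by rewrite big_nil => /(_ h erefl); apply; left.
have one_way h : js (Travel h) * js (Travel (opp_half h)) = 0.
  apply/eqP/contraT; rewrite mulf_eq0 negb_or => /andP[/js_gt0[a1 p1] /js_gt0[a2 p2]].
  have := pos_cycle (opp_half h) [:: Travel h; Travel (opp_half h)].
  rewrite big_cons big_seq1 !netE leNgt => /(_ _)/negP[].
    by split=> //; split=> //; exact: opp_halfK.
  exact: travel_cost_round_trip_gt0.
have one_way_transition h h' : switchable M h h' ->
    js (Transition h h') * js (Transition h' h) = 0.
  move=> sw.
  apply/eqP/contraT; rewrite mulf_eq0 negb_or => /andP[/js_gt0[a1 p1] /js_gt0[a2 p2]].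
  have := pos_cycle h [:: Transition h h'; Transition h' h].
  rewrite big_cons big_seq1 leNgt => /(_ _)/negP[]; first by split.
  exact: M_strict.1.
(* The travel arc into an exit is the only arc there, so regularity makes its current positive. *)
have boundary_regular h : vert M h \in exit M -> 0 < js (Travel h).
  move=> hex; have [[h'|[h1 h2]] [arca ja]] := all_regular h.
    move=> [hE|<-//]; move: arca; rewrite /is_arc hE hex !andbF//.
  have sw : switchable M h1 h2 by case/and3P: arca.
  have hb : vert M h \in entrance M :|: exit M by rewrite inE hex orbT.
  move=> [/= h1E|/= h2E].
    by move: (boundary_not_switchable h2 hb); rewrite -h1E sw.
  by move: (boundary_not_switchable h1 hb); rewrite -h2E switchable_sym sw.
(* If [h'] and [h''] lie on the same edge they coincide, which [one_way_transition] excludes;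
   otherwise the direct transition is strictly cheaper by [M_strict]. *)
have no_detour h h' h'' : switchable M h h' -> switchable M h h'' ->
    js (Transition h' h) * js (Transition h h'') = 0.
  move=> sw' sw''; apply/eqP/contraT.
  rewrite mulf_eq0 negb_or => /andP[/[dup] jn /js_gt0[a1 p1] /js_gt0[a2 p2]].
  have vE : vert M h' = vert M h''.
    by case/andP: sw' => _ /eqP <-; case/andP: sw'' => _ /eqP.
  have hh : h'.1 != h''.1.
    apply/eqP => kE; have h'E := half_edge_vert_inj kE vE.
    have /eqP := one_way_transition _ _ sw'.
    by rewrite mulf_eq0 [in X in X || _]h'E (gt_eqF p2) (gt_eqF p1).
  have sw : switchable M h' h'' by rewrite /switchable hh vE eqxx.
  rewrite switchable_sym in sw'.
  have f1 : switching M h' h \is a fin_num := fin_arc _ a1 p1.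
  have f2 : switching M h h'' \is a fin_num := fin_arc _ a2 p2.
  have := M_strict.2 _ _ _ sw' sw'' sw.
  rewrite ltey_eq fin_numD f1 f2 => /(_ isT).
  have pos : positive_walk M js h' [:: Transition h' h; Transition h h''] h''.
    by split.
  have ws : arc_walk M h' [:: Transition h' h''] h''.
    by split => //; exact: transition_is_arc.
  have := equilibrium_walk_le M_model js_equilibrium pos ws (or_introl erefl).
  by rewrite big_cons !big_seq1/= leNgt => /negP.
have inout h : vert M h \notin exit M ->
    js (Travel (opp_half h)) + \sum_(h' | switchable M h h') js (Transition h h')
    - (js (Travel h) + \sum_(h' | switchable M h h') js (Transition h' h))
    = entry M h.
  by move=> /jsK; rewrite sum_arcs_source// sum_arcs_target.
have entrance_current h : vert M h \in entrance M ->
    js (Travel (opp_half h)) = entry_current M (vert M h) /\ js (Travel h) = 0.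
  move=> hent; have jh : js (Travel h) = 0 by rewrite jsN// /is_arc hent.
  split=> //; have := inout h; rewrite /entry hent jh.
  rewrite !big_pred0;
    try by move=> h'; apply/negbTE/boundary_not_switchable; rewrite inE hent.
  rewrite !addr0 subr0; apply; apply/negP => hex.
  have /disjoint_setI0/setP/(_ (vert M h)) := entrance_exit_disj M.
  by rewrite !inE hent hex.
have balance h : vert M h \notin entrance M :|: exit M ->
    \sum_(h' | switchable M h h') js (Transition h h') = js (Travel h) /\
    \sum_(h' | switchable M h h') js (Transition h' h) = js (Travel (opp_half h)).
  rewrite inE negb_or => /andP[hent hex].
  have := inout h hex; rewrite /entry (negbTE hent).
  set O := (X in _ + X - _); set I := (X in _ - (_ + X)) => io.
  suff : O = js (Travel h) /\ I = js (Travel (opp_half h)) by [].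
  have O0 : 0 <= O by apply: sumr_ge0.
  have I0 : 0 <= I by apply: sumr_ge0.
  (* Transitions do not both bring current to [h] and take it away, and travel is one-way; with all
     four quantities nonnegative, Kirchhoff's law splits into the two balance equations. *)
  have OI : I * O = 0.
    rewrite mulr_suml big1// => h' sw'; rewrite mulr_sumr big1// => h'' sw''.
    exact: no_detour.
  have := one_way h; have := js_ge0 (Travel h); have := js_ge0 (Travel (opp_half h)).
  clearbody O I; move: OI => /eqP; rewrite mulf_eq0 => OI j1 j2 /eqP.
  by rewrite mulf_eq0; case/orP: OI => /eqP ? /orP[]/eqP ?; split; lra.
(* This serves deleted travel arcs, out of reach of [le_arc]: equality on the opposite arc and the
   positive cost of the round trip give the inequality. *)
have travel_le_opp h : is_arc M (Travel (opp_half h)) -> 0 < js (Travel (opp_half h)) ->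
    ((u (opp_half h))%:E <= wardrop_cost M js (Travel h) + (u h)%:E)%E.
  move=> arca ja; have := eq_arc _ arca ja; have := fin_arc _ arca ja.
  have := travel_cost_round_trip_gt0 M_model h
    (js (Travel (h.1, true)) - js (Travel (h.1, false))).
  rewrite !netE /= opp_halfK.
  case: (travel_cost M (opp_half h) _) => // c'.
  case: (travel_cost M h _) => [c| |] //=; last by rewrite leey.
  rewrite -EFinD lte_fin => cc _ [uE].
  by rewrite -EFinD lee_fin; lra.
split.
- by move=> h; exact: js_ge0.
- by move=> h h' _; exact: js_ge0.
- exact: one_way.
- exact: one_way_transition.
- move=> h h' sw; have := le_arc _ (transition_is_arc sw).
  by rewrite /= addeC.
- move=> h h' sw; have [->|jn] := eqVneq (transition_current js h h') 0.
    by rewrite mul0e.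
  have [arca ja] := js_gt0 _ jn.
  have := eq_arc _ arca ja; have := fin_arc _ arca ja => /=.
  case: (switching M h h') => // c _ [->].
  by rewrite -!EFinB -EFinM; congr EFin; ring.
- move=> h; rewrite -netE.
  have [arca|] := boolP (is_arc M (Travel h)); first exact: le_arc _ arca.
  rewrite /is_arc/= negb_and !negbK => bnd.
  (* A deleted travel arc points into an entrance or out of an exit; the opposite arc carries the
     entry current in the first case and a positive current by regularity in the second. *)
  have ja : 0 < js (Travel (opp_half h)).
    case/orP: bnd => [hent|]; last exact: boundary_regular.
    by rewrite (entrance_current h hent).1 entry_current_gt0.
  by apply: travel_le_opp => //; have [] := js_gt0 _ (lt0r_neq0 ja).
- move=> h; rewrite -netE.
  have [->|jn] := eqVneq (edge_current js h) 0; first by rewrite mul0e.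
  have [arca ja] := js_gt0 _ jn.
  have := eq_arc _ arca ja; have := fin_arc _ arca ja.
  case: (wardrop_cost M js (Travel h)) => // c _ [->].
  by rewrite -!EFinB -EFinM; congr EFin; ring.
- by move=> h /balance[].
- by move=> h /balance[].
- exact: entrance_current.
- by move=> h hex; rewrite /edge_current jsN// /is_arc/= opp_halfK hex !andbF.
- by move=> h /u_exit ->.
Qed.
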